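(* For every $n\ge 0$ and each of the ten pairs $(\tau,\mathsf{stat})$ listed below, $$C_n(t,q)=\sum_{\pi\in\mathfrak{S}_n(\tau)}t^{\mathsf{des}\,\pi}q^{\mathsf{stat}\,\pi}.$$ The ten pairs are: (1) $(231,\ 13\text{-}2)$; (2) $(231,\ \mathsf{adi}^* )$; (3) $(312,\ 2\text{-}13)$; (4) $(312,\ \mathsf{adi})$; (5) $(213,\ 31\text{-}2)$; (6) $(132,\ 2\text{-}31)$; (7) $(231,\ 31\text{-}2)$; (8) $(312,\ 2\text{-}31)$; (9) $(213,\ 13\text{-}2)$; (10) $(132,\ 2\text{-}13)$.
   Context: The $(q,t)$-Catalan numbers $C_n(t,q)$ are defined as the Taylor coefficients of the continued fraction $$\sum_{n\ge0}C_n(t,q)z^n=\cfrac{1}{1-\cfrac{c_1z}{1-\cfrac{c_2z}{1-\cfrac{c_3z}{\ddots}}}},\qquad c_{2k-1}=q^{k-1},\ c_{2k}=tq^{k-1}\ (k\ge1).$$ $\mathfrak{S}_n$ is the set of permutations of $[n]$; $\mathfrak{S}_n(\tau)$ is the set of $\pi\in\mathfrak{S}_n$ avoiding the classical pattern $\tau$ (no subsequence order-isomorphic to $\tau$). $\mathsf{des}\,\pi=\#\{i\in[n-1]:\pi(i)>\pi(i+1)\}$. Vincular pattern counts: $(31\text{-}2)\pi=\#\{(i,j): i+1<j\le n,\ \pi(i+1)<\pi(j)<\pi(i)\}$; $(2\text{-}31)\pi=\#\{(i,j): j<i<n,\ \pi(i+1)<\pi(j)<\pi(i)\}$; $(2\text{-}13)\pi=\#\{(i,j):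 j<i<n,\ \pi(i)<\pi(j)<\pi(i+1)\}$; $(13\text{-}2)\pi=\#\{(i,j): i+1<j\le n,\ \pi(i)<\pi(j)<\pi(i+1)\}$. Admissible inversions: set $\pi(n+1)=0$; an inversion pair $(\pi(i),\pi(j))$ (i.e. $1\le i<j\le n$, $\pi(i)>\pi(j)$) is admissible if $\pi(j)<\pi(j+1)$ or there is $l$ with $i<l<j$ and $\pi(l)<\pi(j)$; $\mathsf{adi}\,\pi$ is the number of admissible inversions. Star admissible inversions: set $\pi(0)=n+1$; an inversion pair $(\pi(i),\pi(j))$ with $i<j$ is star admissible if $\pi(i-1)<\pi(i)$ or there is $l$ with $i<l<j$ and $\pi(l)>\pi(i)$; $\mathsf{adi}^*\,\pi$ is their number. *)

(* Defs.v *)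
From HB Require Import structures.
From mathcomp Require Import all_boot all_order all_algebra all_fingroup.
Set Implicit Arguments. Unset Strict Implicit. Unset Printing Implicit Defensive.
Import GRing.Theory.
Local Open Scope ring_scope.

Section ContFrac.
Variables (R : comRingType) (t q : R).

(* c_m for m >= 1: c_{2k-1} = q^{k-1}, c_{2k} = t q^{k-1} *)
Definition cf_coef (m : nat) : R :=
  if odd m then q ^+ m./2 else t * q ^+ (m./2).-1.

(* f_k = 1/(1 - c_{k+1} z f_{k+1}) is the k-th tail of the continued fraction,
   f_0 being the whole continued fraction.  As formal power series this means
   f_k = 1 + c_{k+1} z f_{k+1} f_k, i.e.
   f_k[0] = 1,  f_k[n+1] = c_{k+1} * sum_{i=0}^n f_{k+1}[i] f_k[n-i].
   cf_tails n k = [:: f_k[0]; ...; f_k[n]]. *)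
Fixpoint cf_tails (n : nat) : nat -> seq R :=
  match n with
  | 0 => fun _ => [:: 1]
  | n'.+1 => fun k =>
      rcons (cf_tails n' k)
        (cf_coef k.+1 *
           \sum_(i < n'.+1) (cf_tails n' k.+1)`_i * (cf_tails n' k)`_(n' - i))
  end.

Definition qtCatalan (n : nat) : R := (cf_tails n 0)`_n.

End ContFrac.

(* A permutation pi of [n] is represented by its one-line word
   [:: pi(1); ...; pi(n)] with values in {1..n}; positions are 0-indexed
   in the Coq definitions below: w_a := nth 0 w a = pi(a+1). *)

Local Open Scope nat_scope.

Definition perm_word n (p : 'S_n) : seq nat :=
  [seq (val (p i)).+1 | i <- enum 'I_n].

Definition order_iso (u v : seq nat) : bool :=
  (size u == size v) &&
  [forall i : 'I_(size u), forall j : 'I_(size u),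
     (nth 0 u i < nth 0 u j) == (nth 0 v i < nth 0 v j)].

Definition contains (tau w : seq nat) : bool :=
  [exists m : (size w).-tuple bool, order_iso (mask m w) tau].

Definition avoids (tau w : seq nat) : bool := ~~ contains tau w.

Definition des (w : seq nat) : nat :=
  \sum_(a < size w) (a.+1 < size w) && (nth 0 w a.+1 < nth 0 w a).

Definition st31_2 (w : seq nat) : nat :=
  let n := size w in let x := nth 0 w in
  \sum_(a < n) \sum_(b < n) [&& a.+1 < b, x a.+1 < x b & x b < x a].

Definition st2_31 (w : seq nat) : nat :=
  let n := size w in let x := nth 0 w in
  \sum_(a < n) \sum_(b < n) [&& b < a, a.+1 < n, x a.+1 < x b & x b < x a].

Definition st2_13 (w : seq nat) : nat :=
  let n := size w in let x := nth 0 w in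
  \sum_(a < n) \sum_(b < n) [&& b < a, a.+1 < n, x a < x b & x b < x a.+1].

Definition st13_2 (w : seq nat) : nat :=
  let n := size w in let x := nth 0 w in
  \sum_(a < n) \sum_(b < n) [&& a.+1 < b, x a < x b & x b < x a.+1].

(* admissible inversions, with pi(n+1) = 0 *)
Definition adi (w : seq nat) : nat :=
  let n := size w in
  let x k := if k < n then nth 0 w k else 0 in
  \sum_(a < n) \sum_(b < n)
    [&& a < b, x b < x a &
        (x b < x b.+1) || [exists l : 'I_n, (a < l < b) && (x l < x b)]].

(* star admissible inversions, with pi(0) = n+1 *)
Definition adi_star (w : seq nat) : nat :=
  let n := size w in
  let x k := nth 0 w k in
  let prev a := if a is a'.+1 then x a' else n.+1 in
  \sum_(a < n) \sum_(b < n)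
    [&& a < b, x b < x a &
        (prev a < x a) || [exists l : 'I_n, (a < l < b) && (x a < x l)]].

Local Close Scope nat_scope.

Definition catalan_identity (tau : seq nat) (stat : seq nat -> nat) : Prop :=
  forall (R : comRingType) (t q : R) (n : nat),
    qtCatalan t q n =
    \sum_(p : 'S_n | avoids tau (perm_word p))
      t ^+ des (perm_word p) * q ^+ stat (perm_word p).

(* Main.v *)
(** Reversal and complementation turn each of the ten sums into a sum over
    231-avoiding words, in which [t] marks descents or ascents and [q] marks
    13-2 or 31-2; on the words concerned, adi* and adi coincide with 13-2 and
    2-13.  For 13-2 one cuts a word at its maximum, [w = L m R] with [L < R];
    for 31-2 one cuts after its first letter, [w = a L R] with [L < a < R], and
    refines the sum by a factor recording the first letter.  In every case the
    resulting system of recurrences reduces to the one obtained from the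
    continued fraction [F(z) = 1/(1 - z/(1 - t z F(qz)))], namely
    [F(z) = 1 + z F(z) + t z F(qz) (F(z) - 1)]. *)

Require Import Defs.
From mathcomp Require Import all_boot all_order all_algebra all_fingroup.
From mathcomp Require Import zify ring.
Set Implicit Arguments. Unset Strict Implicit. Unset Printing Implicit Defensive.
Import GRing.Theory.
Local Open Scope ring_scope.

(** * Power series recurrences for the $(q,t)$-Catalan numbers *)

Section CatalanRecurrence.
Variable R : comNzRingType.
Implicit Types f g h : nat -> R.

Definition conv f g n : R := \sum_(i < n.+1) f i * g (n - i)%N.

Lemma eq_conv f f' g g' n :
  (forall i, (i <= n)%N -> f i = f' i) -> (forall i, (i <= n)%N -> g i = g' i) ->
  conv f g n = conv f' g' n.
Proof.
by move=> ff gg; apply: eq_bigr => i _; rewrite ff ?gg ?leq_subr // -ltnS.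
Qed.

(** Coefficient [n] of a product of power series only sees the truncations below [N], so the laws of
    [conv] are inherited from polynomials. *)
Lemma convE f g n N : (n < N)%N ->
  conv f g n = ((\poly_(i < N) f i) * (\poly_(i < N) g i))`_n.
Proof.
move=> nN; rewrite coefM; apply: eq_bigr => i _; rewrite !coef_poly.
by rewrite (leq_ltn_trans _ nN) ?(leq_ltn_trans _ nN) ?leq_subr // -ltnS.
Qed.

Lemma convC f g n : conv f g n = conv g f n.
Proof. by rewrite !(convE _ _ (ltnSn n)) mulrC. Qed.

Lemma convA f g h n : conv f (conv g h) n = conv (conv f g) h n.
Proof.
have coef_conv f1 f2 : \poly_(i < n.+1) conv f1 f2 i =
    \poly_(i < n.+1) ((\poly_(j < n.+1) f1 j) * (\poly_(j < n.+1) f2 j))`_i.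
  by apply/polyP=> i; rewrite !coef_poly; case: ltnP => // /convE ->.
(* Discarding the terms of degree above [n] in a factor leaves coefficient [n] of the product
   unchanged. *)
have coef_trunc (p r : {poly R}) : (\poly_(i < n.+1) p`_i * r)`_n = (p * r)`_n.
  rewrite !coefM; apply: eq_bigr => i _.
  by rewrite coef_poly ltn_ord.
rewrite !(convE _ _ (ltnSn n)) !coef_conv mulrC !coef_trunc.
by rewrite mulrC mulrA.
Qed.

(* The power series identity behind this: [h = 1/(1 - zg)] turns [V = hf]
   into [V = f + zgV]. *)
Lemma conv_elim f g h :
  h 0%N = 1 -> (forall n, h n.+1 = conv h g n) ->
  forall n, conv h f n.+1 = f n.+1 + conv g (conv h f) n.
Proof.
move=> h0 hS n; rewrite {1}/conv big_ord_recl h0 mul1r subn0; congr (_ + _).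
rewrite convA; under eq_bigr do rewrite /= /bump /= add1n subSS hS.
by rewrite -/(conv (conv h g) f n); apply: eq_conv => // i _; apply: convC.
Qed.

(** Coefficientwise form of [F(z) = 1 + z F(z) + t z F(qz) (F(z) - 1)]; as [F - 1] has no constant
    term, the sum stops at [j = n]. *)
Definition catalan_rec (t q : R) f :=
  [/\ f 0%N = 1, f 1%N = 1 &
   forall n, f n.+2 = f n.+1 + t * \sum_(j < n.+1) q ^+ j * f j * f (n.+1 - j)%N].

Lemma catalan_rec_uniq t q f g :
  catalan_rec t q f -> catalan_rec t q g -> f =1 g.
Proof.
move=> [f0 f1 fS] [g0 g1 gS] n; elim/ltn_ind: n => -[|[|n]] IH; rewrite ?f0 ?f1 //.
rewrite fS gS IH //; congr (_ + _ * _); apply: eq_bigr => j _.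
by rewrite !IH // ltnS ?leq_subr // ltnW.
Qed.

Variables t q : R.

Lemma size_cf_tails n k : size (cf_tails t q n k) = n.+1.
Proof. by elim: n k => //= n IH k; rewrite size_rcons IH. Qed.

(** The last entry suffices, since enlarging [n] only appends to [cf_tails n k]. *)
Definition cf_tail k n : R := (cf_tails t q n k)`_n.

Lemma nth_cf_tails n k i : (i <= n)%N -> (cf_tails t q n k)`_i = cf_tail k i.
Proof.
elim: n => [|n IH] in k i *; first by case: i.
rewrite leq_eqVlt => /predU1P [-> // | lt_in].
by rewrite /= nth_rcons size_cf_tails lt_in IH.
Qed.

Lemma cf_tailS k n :
  cf_tail k n.+1 = cf_coef t q k.+1 * conv (cf_tail k.+1) (cf_tail k) n.
Proof.
rewrite {1}/cf_tail /= nth_rcons size_cf_tails ltnn eqxx; congr (_ * _).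
by apply: eq_bigr => i _; rewrite !nth_cf_tails ?leq_subr // -ltnS.
Qed.

Lemma cf_tail0 k : cf_tail k 0 = 1. Proof. by []. Qed.

Lemma cf_coefSS k : cf_coef t q k.+3 = q * cf_coef t q k.+1.
Proof.
rewrite /cf_coef (_ : odd k.+3 = odd k.+1) /= ?negbK //.
rewrite (_ : uphalf k = k.+1./2) //.
case: ifP => ok; first by rewrite -exprS.
(* An even [k.+1] is at least 2, so the predecessor in [cf_coef] is not truncated. *)
have -> : k.+1./2 = (k.+1./2).-1.+1 by lia.
by rewrite exprS /=; ring.
Qed.

(** Going two levels down multiplies every coefficient of the continued fraction by [q], which
    amounts to replacing [z] by [qz]. *)
Lemma cf_tailSS n k : cf_tail k.+2 n = q ^+ n * cf_tail k n.
Proof.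
elim/ltn_ind: n k => -[|n] IH k; first by rewrite !cf_tail0 mul1r.
rewrite !cf_tailS cf_coefSS exprS -!mulrA; congr (_ * _).
rewrite mulrCA; congr (_ * _); rewrite mulr_sumr; apply: eq_bigr => i _.
have le_in : (i <= n)%N by rewrite -ltnS.
have -> : q ^+ n = q ^+ i * q ^+ (n - i) by rewrite -exprD subnKC.
by rewrite !IH ?ltnS ?leq_subr //; ring.
Qed.

(** With [F = f_0], the first two levels read [F = 1 + z f_1 F] and [f_1 = 1 + t z F(qz) f_1];
    [conv_elim] with [h = f_1] eliminates [f_1]. *)
Lemma qtCatalan_rec : catalan_rec t q (qtCatalan t q).
Proof.
have c1 : cf_coef t q 1 = 1 by [].
have c2 : cf_coef t q 2 = t by rewrite /cf_coef /= mulr1.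
change (catalan_rec t q (cf_tail 0)).
have CS n : cf_tail 0 n.+1 = conv (cf_tail 1) (cf_tail 0) n.
  by rewrite cf_tailS c1 mul1r.
split=> //; first by rewrite CS /conv big_ord1 mul1r.
move=> n; rewrite CS (@conv_elim _ (fun j => t * q ^+ j * cf_tail 0 j)) //.
  congr (_ + _); rewrite mulr_sumr; apply: eq_bigr => j _.
  by rewrite -CS -subSn ?mulrA // -ltnS.
move=> {}n; rewrite cf_tailS c2 convC mulr_sumr; apply: eq_bigr => i _.
by rewrite cf_tailSS; ring.
Qed.

(** The term [k = 0], an empty left block, is the summand free of [t]; the others, reindexed by the
    size of the right block, form the [t]-sum. *)
Lemma catalan_rec_max_asc f : f 0%N = 1 ->
  (forall n, f n.+1 = \sum_(k < n.+1) t ^+ (0 < k)%N *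
      q ^+ ((0 < k) * (n - k))%N * f k * f (n - k)%N) ->
  catalan_rec t q f.
Proof.
move=> f0 fS.
have f1 : f 1%N = 1 by rewrite fS big_ord1 f0 !mulr1 expr0.
split=> // n; rewrite fS big_ord_recl /= f0 subn0 !expr0 !mul1r; congr (_ + _).
rewrite mulr_sumr (reindex_inj rev_ord_inj); apply: eq_bigr => j _ /=.
rewrite /bump /= !add1n !subSS mul1n expr1.
have -> : (n - (n - j) = j)%N by have := ltn_ord j; lia.
have -> : ((n - j).+1 = n.+1 - j)%N by have := ltn_ord j; lia.
by ring.
Qed.

(** Here the summand free of [t] is the last one, where the right block is empty. *)
Lemma catalan_rec_max_des f : f 0%N = 1 ->
  (forall n, f n.+1 = \sum_(k < n.+1) t ^+ (0 < n - k)%N *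
      q ^+ ((0 < k) * (n - k))%N * f k * f (n - k)%N) ->
  catalan_rec t q f.
Proof.
move=> f0 fS.
have f1 : f 1%N = 1 by rewrite fS big_ord1 f0 !mulr1 expr0.
split=> // n; rewrite fS big_ord_recr /= subnn f0 muln0 !expr0 !mul1r mulr1 addrC.
(* The term [k = 0] carries no power of [q] and is the summand [j = 0] of [catalan_rec]; the others
   match in reverse order. *)
congr (_ + _); rewrite !big_ord_recl mulrDr /= f0 !subn0 !expr0 !mulr1 !mul1r.
congr (_ + _); rewrite mulr_sumr (reindex_inj rev_ord_inj); apply: eq_bigr => j _ /=.
rewrite /bump /= !add1n !subSS mul1n.
have -> : (n - (n - j.+1) = j.+1)%N by have := ltn_ord j; lia.
have -> : ((n - j.+1).+1 = n - j)%N by have := ltn_ord j; lia.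
by rewrite expr1; ring.
Qed.

(** For [K = 1 + t (H - 1)] the hypotheses say [F = 1 + z K F] and [K = 1 + t z F(qz) K], the first
    two levels of the continued fraction with [K] as [f_1]. *)
Lemma catalan_rec_head_des f h : f 0%N = 1 -> h 0%N = 1 ->
  (forall n, f n.+1 = \sum_(k < n.+1) t ^+ (0 < k)%N * h k * f (n - k)%N) ->
  (forall n, h n.+1 =
     \sum_(k < n.+1) t ^+ (0 < k)%N * q ^+ (n - k) * h k * f (n - k)%N) ->
  catalan_rec t q f.
Proof.
move=> f0 h0 fS hS.
pose k j := t ^+ (0 < j)%N * h j; pose g j := t * q ^+ j * f j.
have {}fS n : f n.+1 = conv k f n by rewrite fS.
split=> //; first by rewrite fS /conv big_ord1 f0 /k h0 !mulr1.
move=> n; rewrite fS (@conv_elim _ g).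
- congr (_ + _); rewrite mulr_sumr; apply: eq_bigr => j _.
  by rewrite -fS -subSn ?mulrA // -ltnS.
- by rewrite /k h0 mulr1.
move=> {}n; rewrite /k hS mulr_sumr; apply: eq_bigr => j _; rewrite /g /= expr1.
by ring.
Qed.

(** For [P = 1 + t (F - 1)] the hypotheses say [F = 1 + z H P] and [H = 1 + z P(qz) H]; eliminating
    [H] gives [F = 1 + z (P + P(qz) (F - 1))], and the terms [t (F - 1)] cancel. *)
Lemma catalan_rec_head_asc f h : f 0%N = 1 -> h 0%N = 1 ->
  (forall n, f n.+1 = \sum_(k < n.+1) t ^+ (0 < n - k)%N * h k * f (n - k)%N) ->
  (forall n, h n.+1 =
     \sum_(k < n.+1) t ^+ (0 < n - k)%N * q ^+ (n - k) * h k * f (n - k)%N) ->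
  catalan_rec t q f.
Proof.
move=> f0 h0 fS hS.
pose p j := t ^+ (0 < j)%N * f j; pose g j := t ^+ (0 < j)%N * q ^+ j * f j.
have {}fS n : f n.+1 = conv h p n.
  by rewrite fS; apply: eq_bigr => j _; rewrite /p; ring.
split=> //; first by rewrite fS /conv big_ord1 /p f0 h0 !mulr1.
move=> n; rewrite fS (@conv_elim _ g) //.
  have -> : conv g (conv h p) n = conv g (fun i => f i.+1) n.
    by apply: eq_conv => // i _; rewrite fS.
  (* The term [t * f n.+1] becomes the summand [j = 0] of the target, while the first term of the
     convolution, where [g 0 = 1], becomes the summand free of [t]. *)
  rewrite /p expr1 /conv [RHS]addrC !big_ord_recl mulrDr /= /g f0 !expr0 !mul1r.
  rewrite !subn0 -addrA; congr (_ + _); rewrite addrC; congr (_ + _).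
  rewrite mulr_sumr; apply: eq_bigr => j _ /=; rewrite /bump /= add1n.
  have -> : (n - j.+1).+1 = (n.+1 - j.+1)%N by have := ltn_ord j; lia.
  by rewrite expr1 !mulrA.
by move=> {}n; rewrite hS; apply: eq_bigr => j _; rewrite /g; ring.
Qed.

End CatalanRecurrence.

(** * Decompositions of 231-avoiding words *)

Local Open Scope nat_scope.

(** Avoidance as a recursion on the word, so that cuts of a word can be treated with [pairwise]. *)
Fixpoint avoids3 (P : nat -> nat -> nat -> bool) (s : seq nat) : bool :=
  if s is a :: s' then pairwise (fun b c => ~~ P a b c) s' && avoids3 P s'
  else true.

Lemma avoids3_map P f s :
  avoids3 P (map f s) = avoids3 (fun a b c => P (f a) (f b) (f c)) s.
Proof. by elim: s => //= a s ->; rewrite pairwise_map. Qed.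

Lemma pairwise_subseq2P (r : rel nat) s :
  reflect (forall b c, subseq [:: b; c] s -> r b c) (pairwise r s).
Proof.
elim: s => [|a s IH]; first by apply: ReflectT => b c.
rewrite pairwise_cons; apply: (iffP andP) => [[/allP ras /IH rs] b c|rs].
  by rewrite [subseq _ _]/=; case: eqP => [-> | _ /rs //]; rewrite sub1seq => /ras.
split; last by apply/IH => b c bc; apply: rs; apply: subseq_trans bc (subseq_cons _ _).
by apply/allP => b sb; apply: rs; rewrite /= eqxx sub1seq.
Qed.

Lemma avoids3P P s :
  reflect (forall a b c, subseq [:: a; b; c] s -> ~~ P a b c) (avoids3 P s).
Proof.
elim: s => [|x s IH]; first by apply: ReflectT => a b c.
apply: (iffP andP) => [[/pairwise_subseq2P Px /IH Ps] a b c|Ps].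
  by rewrite [subseq _ _]/=; case: eqP => [-> /Px | _ /Ps].
split; last first.
  by apply/IH => a b c abc; apply: Ps; apply: subseq_trans abc (subseq_cons _ _).
by apply/pairwise_subseq2P => b c bc; apply: Ps; rewrite /= eqxx.
Qed.

Lemma avoids3_nth P s i j k : avoids3 P s -> i < j < k -> k < size s ->
  ~~ P (nth 0 s i) (nth 0 s j) (nth 0 s k).
Proof.
move=> + /andP[ij jk] ks; elim: s i j k ij jk ks => // x s IH i [|j] [|k] // ij jk ks.
move=> /= /andP[/(pairwiseP 0) Px /IH Ps]; case: i ij => [|i] ij; last exact: Ps.
by apply: (Px j k); rewrite ?unfold_in /=; move: jk ks; rewrite /= ?ltnS => jk ks; lia.
Qed.

Lemma avoids3_rev P s : avoids3 P (rev s) = avoids3 (fun a b c => P c b a) s.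
Proof.
apply/avoids3P/avoids3P => Ps a b c abc; apply: Ps.
  by rewrite -[_ :: _]/(rev [:: a; b; c]) subseq_rev.
by rewrite -subseq_rev.
Qed.

Lemma eq_in_avoids3 P Q s :
  {in s & s & s, forall a b c, P a b c = Q a b c} -> avoids3 P s = avoids3 Q s.
Proof.
move=> PQ; apply/avoids3P/avoids3P => Ps a b c abc;
  have /mem_subseq abcs := abc; move: (Ps _ _ _ abc);
  by rewrite PQ // abcs // !inE eqxx ?orbT.
Qed.

Lemma order_iso3 a b c x y z : order_iso [:: a; b; c] [:: x; y; z] =
  [&& (a < b) == (x < y), (a < c) == (x < z), (b < a) == (y < x),
      (b < c) == (y < z), (c < a) == (z < x) & (c < b) == (z < y)].
Proof.
rewrite /order_iso /=; apply/'forall_forallP/idP => [H|/and5P[? ? ? ? /andP[? ?]]].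
  pose o i (lt_i3 : i < 3) : 'I_3 := Ordinal lt_i3.
  have [o0 o1 o2] : [/\ 0 < 3, 1 < 3 & 2 < 3] by [].
  by rewrite (H (o 0 o0) (o 1 o1)) (H (o 0 o0) (o 2 o2)) (H (o 1 o1) (o 0 o0))
    (H (o 1 o1) (o 2 o2)) (H (o 2 o2) (o 0 o0)) (H (o 2 o2) (o 1 o1)).
by case=> [[|[|[|i]]] ?] [[|[|[|j]]] ?] //=; rewrite !ltnn.
Qed.

(** Masks and [subseq] describe the same subsequences, and [order_iso] forces length 3. *)
Lemma avoidsE x y z w : avoids [:: x; y; z] w =
  avoids3 (fun a b c => order_iso [:: a; b; c] [:: x; y; z]) w.
Proof.
rewrite /avoids /contains; apply/idP/avoids3P => [+ a b c /subseqP[m sz_m abc] | Ps].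
  by apply: contra => iso; apply/existsP; exists (Tuple (introT eqP sz_m)); rewrite -abc.
apply/negP => /existsP[m iso]; have /andP[/eqP sz _] := iso.
have := mask_subseq m w.
by case: (mask m w) iso sz => [|a [|b [|c []]]] // iso _ /Ps; rewrite iso.
Qed.

Definition P231 a b c := (c < a) && (a < b).
Local Notation av231 := (avoids3 P231).

Lemma av231_shift k s : av231 (map (addn k) s) = av231 s.
Proof.
rewrite avoids3_map; apply: eq_in_avoids3 => a b c _ _ _.
by rewrite /P231 !ltn_add2l.
Qed.

(** The last letter of a 231 is its smallest, so no occurrence can start in [L] and end in [R]. *)
Lemma av231_cat L R : {in L & R, forall x y, x < y} ->
  av231 (L ++ R) = av231 L && av231 R.
Proof.
elim: L => //= x L IH LR.
have LR' : {in L & R, forall x y, x < y}.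
  by move=> y z yL zR; apply: LR; rewrite // inE yL orbT.
rewrite IH // pairwise_cat andbA; congr (_ && _ && _).
have xR z : z \in R -> x < z by apply: LR; rewrite mem_head.
have -> : pairwise (fun b c => ~~ P231 x b c) R.
  apply/pairwise_subseq2P => b c /mem_subseq bcR.
  by have := xR c (bcR c _); rewrite !inE eqxx orbT /P231 => /(_ isT); lia.
rewrite andbT (_ : allrel _ _ _) //; apply/allrelP => b c _ /xR.
by rewrite /P231; lia.
Qed.

(** Sorting the two blocks separately already sorts the whole word, so the sorted blocks are the two
    pieces of the interval. *)
Lemma perm_cat_iota m n L R : perm_eq (L ++ R) (iota m n) ->
  {in L & R, forall x y, x < y} ->
  perm_eq L (iota m (size L)) && perm_eq R (iota (m + size L) (size R)).
Proof.
move=> LRn LR; set s := sort leq L ++ sort leq R.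
have def_s : s = iota m n.
  apply: (sorted_eq leq_trans anti_leq); last 1 first.
  - by apply: perm_trans LRn; rewrite perm_cat // perm_sort.
  - rewrite (sorted_pairwise leq_trans) pairwise_cat.
    rewrite -!(sorted_pairwise leq_trans) !(sort_sorted leq_total) !andbT.
    by apply/allrelP => x y; rewrite !mem_sort => xL yR; apply/ltnW/LR.
  by apply: sub_sorted (iota_ltn_sorted _ _) => x y /ltnW.
have sz_n : n = size L + size R.
  by have:= perm_size LRn; rewrite size_cat size_iota.
move/eqP: def_s; rewrite sz_n iotaD eqseq_cat ?size_sort ?size_iota //.
move=> /andP[/eqP <- /eqP <-].
by rewrite ![perm_eq _ (sort _ _)]perm_sym !perm_sort !perm_refl.
Qed.

(** * Words avoiding 231 and two ways of gluing them *)

Definition words n := [seq w <- permutations (iota 1 n) | av231 w].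

Lemma mem_words w n : (w \in words n) = av231 w && perm_eq w (iota 1 n).
Proof. by rewrite mem_filter mem_permutations. Qed.

Lemma words_size w n : w \in words n -> size w = n.
Proof. by rewrite mem_words => /andP[_ /perm_size ->]; rewrite size_iota. Qed.

Lemma words_val w n x : w \in words n -> x \in w -> 0 < x <= n.
Proof.
by rewrite mem_words => /andP[_ /perm_mem ->]; rewrite mem_iota add1n ltnS.
Qed.

Lemma words_uniq w n : w \in words n -> uniq w.
Proof. by rewrite mem_words => /andP[_ /perm_uniq ->]; apply: iota_uniq. Qed.

Lemma perm_shift k m n s :
  perm_eq (map (addn k) s) (iota (k + m) n) = perm_eq s (iota m n).
Proof.
rewrite iotaDl; apply/idP/idP; last exact: perm_map.
by apply: perm_map_inj; apply: addnI.
Qed.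

Lemma unshift k s n : perm_eq s (iota k.+1 n) ->
  exists2 s', s = map (addn k) s' & perm_eq s' (iota 1 n).
Proof.
move=> sn; have def_s : s = map (addn k) (map (subn^~ k) s).
  rewrite -map_comp map_id_in // => x; rewrite (perm_mem sn) mem_iota /= => /andP[kx _].
  by rewrite subnKC // ltnW.
by exists (map (subn^~ k) s); rewrite // -(perm_shift k) -def_s addn1.
Qed.

(** Inverse of the cut at the maximum: [X] is the left block, and [Y] is the right block with its
    letters lowered to start at 1. *)
Definition glue_max (X Y : seq nat) :=
  X ++ (size X + size Y).+1 :: map (addn (size X)) Y.

(** Inverse of the cut after the first letter, which exceeds exactly the letters of [X]. *)
Definition glue_head (X Y : seq nat) :=
  (size X).+1 :: X ++ map (addn (size X).+1) Y.

Section Glue.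
Variables (X Y : seq nat) (k l : nat).
Hypotheses (Xk : X \in words k) (Yl : Y \in words l).

Lemma glue_max_ltl x y :
  x \in X -> y \in (size X + size Y).+1 :: map (addn (size X)) Y -> x < y.
Proof.
move=> /(words_val Xk) /andP[_ xk]; rewrite inE (words_size Xk).
case/predU1P=> [->|/mapP[y' /(words_val Yl) ? ->]]; lia.
Qed.

Lemma glue_max_ltr y : y \in map (addn (size X)) Y -> y < (size X + size Y).+1.
Proof. by clear Xk; case/mapP=> y' /(words_val Yl); rewrite (words_size Yl) => ? ->; lia. Qed.

Lemma glue_head_ltr x : x \in map (addn (size X).+1) Y -> (size X).+1 < x.
Proof. by clear Xk; case/mapP=> y' /(words_val Yl) ? ->; lia. Qed.

Lemma glue_head_ltl x : x \in X -> x < (size X).+1.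
Proof. by move/(words_val Xk); rewrite (words_size Xk) ltnS => /andP[]. Qed.

Lemma glue_max_words : glue_max X Y \in words (k + l).+1.
Proof.
rewrite mem_words av231_cat; last exact: glue_max_ltl.
have [] := (Xk, Yl); rewrite !mem_words => /andP[-> kX] /andP[Yav lY] /=.
rewrite av231_shift Yav andbT; apply/andP; split.
  by apply/pairwise_subseq2P => b c /mem_subseq/(_ b (mem_head _ _))/glue_max_ltr;
    rewrite /P231; lia.
rewrite /glue_max (words_size Xk) (words_size Yl).
rewrite -[1 :: _]/(iota 1 (k + l).+1) -addnS (iotaD 1 k l.+1) perm_cat //.
rewrite -{2}[l.+1]addn1 iotaD perm_sym perm_catC perm_sym /= add1n addSnnS.
by rewrite perm_cons -addn1 perm_shift.
Qed.

Lemma glue_head_words : glue_head X Y \in words (k + l).+1.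
Proof.
have ltXY : {in X & map (addn (size X).+1) Y, forall x y, x < y}.
  by move=> x y /glue_head_ltl ? /glue_head_ltr; apply: ltn_trans.
rewrite mem_words /= av231_cat // av231_shift.
have [] := (Xk, Yl); rewrite !mem_words => /andP[-> kX] /andP[-> lY] /=.
rewrite andbT pairwise_cat; apply/andP; split.
  have P0 b c : (b < (size X).+1) || ((size X).+1 < c) -> ~~ P231 (size X).+1 b c.
    by rewrite /P231; lia.
  apply/and3P; split; first by apply/allrelP => b c /glue_head_ltl bX _; rewrite P0 ?bX.
    by apply/pairwise_subseq2P => b c /mem_subseq/(_ b (mem_head _ _))/glue_head_ltl bX;
      rewrite P0 ?bX.
  apply/pairwise_subseq2P => b c /mem_subseq/(_ c).
  by rewrite !inE eqxx orbT => /(_ isT)/glue_head_ltr cX; rewrite P0 // cX orbT.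
rewrite /glue_head (words_size Xk) perm_sym.
rewrite -[1 :: _]/(iota 1 (k + l).+1) -addnS (iotaD 1 k l.+1) /= -cat1s perm_catCA.
by rewrite /= add1n perm_cons perm_cat 1?perm_sym // -[k.+2]addn1 perm_shift.
Qed.

End Glue.

(** For [x] before and [y] after the maximum [n.+1], the letters [x], [n.+1], [y] form a 231 unless
    [x < y]. *)
Lemma glue_max_surj n w : w \in words n.+1 ->
  exists X Y, [/\ X \in words (size X), Y \in words (size Y) & w = glue_max X Y].
Proof.
move=> wn; have := wn; rewrite mem_words => /andP[wav wP].
have nw : n.+1 \in w by rewrite (perm_mem wP) mem_iota; lia.
have w_uniq := words_uniq wn; have wval x := @words_val w _ x wn.
case/splitPr: nw wav wP w_uniq wval => X R wav wP w_uniq wval {wn w}.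
move: (w_uniq); rewrite cat_uniq cons_uniq => /and3P[_ /hasPn XR0 /andP[nR _]].
have ltR y : y \in R -> y < n.+1.
  move=> yR; have := wval y; rewrite mem_cat inE yR !orbT => /(_ isT).
  by have : y != n.+1 by [apply: contraNneq nR => <-]; lia.
have XR : {in X & R, forall x y, x < y}.
  move=> x y xX yR.
  have /(avoids3P _ _ wav) : subseq ([:: x] ++ [:: n.+1; y]) (X ++ n.+1 :: R).
    by apply: cat_subseq; rewrite ?sub1seq //= eqxx sub1seq.
  have := wval x; rewrite mem_cat xX => /(_ isT).
  have : x != y by apply: contraTneq xX => ->; apply: XR0; rewrite inE yR orbT.
  have : x != n.+1 by apply: contraTneq xX => ->; apply: XR0; rewrite mem_head.
  by rewrite /P231; lia.
have Xn x : x \in X -> x < n.+1.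
  move=> xX; have := wval x; rewrite mem_cat xX => /(_ isT).
  have : x != n.+1 by apply: contraTneq xX => ->; apply: XR0; rewrite mem_head.
  by lia.
(* Moving the maximum to the end puts the three blocks in increasing order, as [perm_cat_iota]
   requires. *)
have wP' : perm_eq (X ++ (R ++ [:: n.+1])) (iota 1 n.+1).
  by apply: perm_trans wP; rewrite perm_cat2l perm_catC.
have /andP[XP RP] : perm_eq X (iota 1 (size X)) &&
    perm_eq (R ++ [:: n.+1]) (iota (1 + size X) (size (R ++ [:: n.+1]))).
  apply: perm_cat_iota wP' _ => x y xX; rewrite mem_cat inE => /orP[yR|/eqP->].
    exact: XR.
  exact: Xn.
have {RP} /andP[RP _] : perm_eq R (iota (1 + size X) (size R)) &&
    perm_eq [:: n.+1] (iota (1 + size X + size R) 1).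
  by apply: perm_cat_iota RP _ => x y /ltR ?; rewrite inE => /eqP ->.
have [Y def_R YP] := unshift RP.
have sz_n : n = size X + size R.
  by have := perm_size wP; rewrite size_cat size_iota /= addnS => -[].
have ltXR : {in X & n.+1 :: R, forall x y, x < y}.
  by move=> x y xX; rewrite inE => /predU1P[->|]; [apply: Xn | apply: XR].
move: wav; rewrite av231_cat // def_R /= av231_shift => /and3P[Xav _ Yav].
exists X, Y; rewrite !mem_words Xav Yav XP; split=> //.
  by rewrite def_R size_map in YP.
by rewrite /glue_max sz_n def_R size_map.
Qed.

(** After the first letter [a], a letter above [a] is never followed by one below [a], so the small
    letters all precede the large ones. *)
Lemma glue_head_surj n w : w \in words n.+1 ->
  exists X Y, [/\ X \in words (size X), Y \in words (size Y) & w = glue_head X Y].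
Proof.
move=> wn; have := wn; have := words_uniq wn; rewrite mem_words => + /andP[wav wP].
case: w wn wav wP => [|a s] wn; first by move=> _ /perm_size; rewrite size_iota.
rewrite /= => /andP[av_a av_s] wP /andP[a_s _].
pose L := [seq x <- s | x < a]; pose R := [seq x <- s | a < x].
have def_s : s = L ++ R.
  rewrite /L /R {wn wP L R av_s}; elim: s a_s av_a => //= x s IH.
  rewrite inE negb_or => /andP[ax a_s] /andP[/allP xs /(IH a_s) {IH} def_s].
  case: ltngtP ax => // [xa | ax] _; first by rewrite /= -def_s.
  have L0 : [seq x <- s | x < a] = [::].
    apply/eqP; rewrite -[_ == _]negbK -has_filter; apply/hasPn => z /xs.
    by rewrite /P231; lia.
  by move: def_s; rewrite L0 /= => <-.
have La x : x \in L -> x < a by rewrite mem_filter => /andP[].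
have Ra x : x \in R -> a < x by rewrite mem_filter => /andP[].
have LR : {in L & R, forall x y, x < y}.
  by move=> x y /La xa /Ra; apply: ltn_trans.
have wP' : perm_eq (L ++ (a :: R)) (iota 1 n.+1).
  by apply: perm_trans wP; rewrite def_s -cat1s perm_catCA.
have /andP[LP RP] : perm_eq L (iota 1 (size L)) &&
    perm_eq ([:: a] ++ R) (iota (1 + size L) (size R).+1).
  apply: perm_cat_iota wP' _ => x y xL; rewrite inE => /predU1P[->|yR].
    exact: La.
  exact: LR.
have {RP} /andP[aP RP] : perm_eq [:: a] (iota (1 + size L) 1) &&
    perm_eq R (iota (1 + size L + 1) (size R)).
  by apply: perm_cat_iota RP _ => x y; rewrite inE => /eqP -> /Ra.
have {aP} def_a : a = (size L).+1.
  by have := perm_mem aP a; rewrite !inE eqxx => /esym/eqP.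
have [Y def_R YP] : exists2 Y, R = map (addn (size L).+1) Y & perm_eq Y (iota 1 (size R)).
  by apply: unshift; rewrite add1n addn1 in RP.
move: av_s; rewrite def_s av231_cat // {1}def_R av231_shift => /andP[Lav Yav].
exists L, Y; rewrite !mem_words Lav Yav LP; split=> //.
  by rewrite def_R size_map in YP.
by rewrite /glue_head -def_R -def_a.
Qed.

(** The position of the maximum recovers the size of [X]. *)
Lemma glue_max_inj k l k' l' X Y X' Y' :
  X \in words k -> Y \in words l -> X' \in words k' -> Y' \in words l' ->
  glue_max X Y = glue_max X' Y' -> X = X' /\ Y = Y'.
Proof.
move=> Xk Yl Xk' Yl' eqg.
have idx Z Z' m m' : Z \in words m -> Z' \in words m' ->
    index (size Z + size Z').+1 (glue_max Z Z') = size Z.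
  move=> Zm Zm'; rewrite /glue_max index_cat index_head addn0.
  case: ifP => // /(glue_max_ltl Zm Zm')/(_ (mem_head _ _)).
  by rewrite ltnn.
have sz : size X + size Y = size X' + size Y'.
  have := congr1 size eqg; rewrite /glue_max !size_cat /= !size_map.
  by rewrite !addnS => -[].
have szX : size X = size X' by rewrite -(idx _ _ _ _ Xk Yl) eqg sz (idx _ _ _ _ Xk' Yl').
move/eqP: eqg; rewrite /glue_max eqseq_cat // => /andP[/eqP -> /eqP[_]].
by move=> /(inj_map (@addnI _)).
Qed.

Lemma glue_head_inj X Y X' Y' :
  glue_head X Y = glue_head X' Y' -> X = X' /\ Y = Y'.
Proof.
rewrite /glue_head => -[szX] /eqP; rewrite eqseq_cat // => /andP[/eqP -> /eqP].
by move=> /(inj_map (@addnI _)).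
Qed.

Section SumGlue.
Variables (V : nmodType) (glue : seq nat -> seq nat -> seq nat).
Hypothesis glue_words : forall X Y k l,
  X \in words k -> Y \in words l -> glue X Y \in words (k + l).+1.
Hypothesis glue_surj : forall n w, w \in words n.+1 ->
  exists X Y, [/\ X \in words (size X), Y \in words (size Y) & w = glue X Y].
Hypothesis glue_inj : forall k l k' l' X Y X' Y',
  X \in words k -> Y \in words l -> X' \in words k' -> Y' \in words l' ->
  glue X Y = glue X' Y' -> X = X' /\ Y = Y'.

Lemma sum_words_glue (F : seq nat -> V) n :
  (\sum_(w <- words n.+1) F w =
   \sum_(k < n.+1) \sum_(X <- words k) \sum_(Y <- words (n - k)) F (glue X Y))%R.
Proof.
pose pairs k := [seq (X, Y) | X <- words k, Y <- words (n - k)].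
pose gl (k : nat) (p : seq nat * seq nat) := glue p.1 p.2.
have mem_pairs k p : p \in pairs k -> p.1 \in words k /\ p.2 \in words (n - k).
  by case/allpairsPdep => X [Y [? ? ->]].
have uniq_words m : uniq (words m) by rewrite filter_uniq ?permutations_uniq.
have perm_w : perm_eq (words n.+1) [seq gl k p | k <- iota 0 n.+1, p <- pairs k].
  apply: uniq_perm => //.
    apply: allpairs_uniq_dep; first exact: iota_uniq.
      by move=> k _; apply: allpairs_uniq => // -[X Y] [X' Y'] _ _ [-> ->].
    (* Different [k] give different words, since the glued word determines [X] and hence its size
       [k]. *)
    move=> u v /allpairsPdep[k [[X Y] [_ /mem_pairs[Xk Yk] ->]]].
    move=> /allpairsPdep[k' [[X' Y'] [_ /mem_pairs[Xk' Yk'] ->]]] eqg.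
    have [eX eY] := glue_inj Xk Yk Xk' Yk' eqg.
    by move: eX eY; rewrite -(words_size Xk) -(words_size Xk') /= => -> ->.
  move=> w; apply/idP/allpairsPdep => [wn|[k [p [+ /mem_pairs[pk pn] ->]]]].
    have [X [Y [Xw Yw def_w]]] := glue_surj wn.
    have szn : n = size X + size Y.
      have := words_size (glue_words Xw Yw).
      by rewrite -def_w (words_size wn) => -[].
    exists (size X), (X, Y); rewrite mem_iota /= szn add0n ltnS leq_addr; split=> //.
    by apply: allpairs_f; rewrite ?szn ?addKn.
  by rewrite mem_iota add0n ltnS => /= kn; rewrite -(subnKC kn) glue_words.
rewrite (perm_big _ perm_w) big_allpairs_dep.
rewrite -[iota 0 n.+1]/(index_iota 0 n.+1) big_mkord; apply: eq_bigr => k _.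
by rewrite big_allpairs_dep.
Qed.
End SumGlue.

(** * Adjacency statistics of words *)

Fixpoint adj (r : rel nat) (s : seq nat) : nat :=
  if s is x :: s' then (if s' is y :: _ then r x y else false) + adj r s' else 0.

Lemma adj_cons2 r x y s : adj r (x :: y :: s) = r x y + adj r (y :: s).
Proof. by []. Qed.

Lemma adj_cat r x L m R :
  adj r (x :: L ++ m :: R) = adj r (x :: L) + r (last x L) m + adj r (m :: R).
Proof. by elim: L x => [|y L IH] x //; rewrite cat_cons !adj_cons2 IH /=; lia. Qed.

Lemma adj_map r f s : adj r (map f s) = adj (relpre f r) s.
Proof. by elim: s => //= x [|y s] //= ->. Qed.

Lemma eq_in_adj r r' s : {in s &, r =2 r'} -> adj r s = adj r' s.
Proof.
elim: s => //= x s IH rr'; rewrite IH => [|y z ys zs]; last first.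
  by apply: rr'; rewrite inE ?ys ?zs orbT.
by case: s rr' {IH} => // y s -> //; rewrite !inE eqxx ?orbT.
Qed.

Lemma adj_rev r s : adj r (rev s) = adj (fun x y => r y x) s.
Proof.
elim: s => // x [|y s] // IH; rewrite adj_cons2 -IH !rev_cons -!cats1 -catA.
case: (rev s) => [|z s']; first by rewrite /= !addn0.
by rewrite !cat_cons !adj_cat /= !addn0; lia.
Qed.

Lemma desE w : des w = adj gtn w.
Proof.
elim: w => [|x w IH]; first by rewrite /des big_ord0.
by rewrite /des [size _]/= big_ord_recl [RHS]/= -IH; congr (_ + _); case: w {IH}.
Qed.

(* Counts vincular patterns: [x], [y] are adjacent letters and [z] comes later. *)
Fixpoint fstat (P : nat -> nat -> nat -> bool) (s : seq nat) : nat :=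
  if s is x :: s' then
    (if s' is y :: s'' then count (P x y) s'' else 0) + fstat P s'
  else 0.

Lemma fstat_cons2 P x y s :
  fstat P (x :: y :: s) = count (P x y) s + fstat P (y :: s).
Proof. by []. Qed.

(** No pair inside the first block is completed by a letter of the second, so the only crossing
    occurrences use the adjacent pair that straddles the cut. *)
Lemma fstat_cat P x L m R :
  {in x :: L &, forall y z, all (fun u => ~~ P y z u) (m :: R)} ->
  fstat P (x :: L ++ m :: R) =
  fstat P (x :: L) + count (P (last x L) m) R + fstat P (m :: R).
Proof.
elim: L x => [|y L IH] x PLR //.
have PL : {in y :: L &, forall y z, all (fun u => ~~ P y z u) (m :: R)}.
  by move=> u v uL vL; apply: PLR; rewrite inE ?uL ?vL orbT.
rewrite cat_cons !fstat_cons2 IH // [last x _]/=.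
have Pxy : count (P x y) (m :: R) = 0.
  apply/eqP; rewrite -leqn0 leqNgt -has_count -all_predC.
  by apply: PLR; rewrite !inE eqxx ?orbT.
rewrite count_cat Pxy. by rewrite addn0 !addnA.
Qed.

Lemma fstat_map P f s :
  fstat P (map f s) = fstat (fun x y z => P (f x) (f y) (f z)) s.
Proof. by elim: s => //= x [|y s] //= ->; rewrite count_map. Qed.

Lemma eq_in_fstat P Q s :
  {in s & s & s, forall x y z, P x y z = Q x y z} -> fstat P s = fstat Q s.
Proof.
elim: s => //= x s IH PQ; rewrite IH => [|y z u ys zs us]; last first.
  by apply: PQ; rewrite inE ?ys ?zs ?us orbT.
case: s PQ {IH} => // y s PQ; congr (_ + _); apply: eq_in_count => z zs.
by apply: PQ; rewrite !inE ?eqxx ?zs ?orbT.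
Qed.

(** [fsum] and [bsum] are the double sums to which the four vincular counts unfold, according to
    whether the isolated letter comes after or before the adjacent pair. *)
Definition fsum P (w : seq nat) := let x := nth 0 w in
  \sum_(a < size w) \sum_(b < size w) ((a.+1 < b) && P (x a) (x a.+1) (x b)).

Definition bsum P (w : seq nat) := let x := nth 0 w in
  \sum_(a < size w) \sum_(b < size w)
    [&& b < a, a.+1 < size w & P (x a) (x a.+1) (x b)].

Lemma count_nth (p : pred nat) s : count p s = \sum_(b < size s) p (nth 0 s b).
Proof.
by elim: s => [|x s IH] /=; rewrite ?big_ord0 // big_ord_recl IH.
Qed.

Lemma fsumE P w : fsum P w = fstat P w.
Proof.
elim: w => [|x w IH]; first by rewrite /fsum big_ord0.
rewrite /fsum [size _]/= big_ord_recl [RHS]/= -IH; congr (_ + _).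
  case: w {IH} => [|y w]; first by rewrite big_ord1.
  by rewrite [size _]/= !big_ord_recl count_nth.
by apply: eq_bigr => a _; rewrite big_ord_recl.
Qed.

(** Reversal moves the isolated letter behind the adjacent pair and swaps the letters of that
    pair. *)
Lemma bsumE P w : bsum P w = fstat (fun x y z => P y x z) (rev w).
Proof.
rewrite -fsumE /bsum /fsum size_rev.
case def_n: (size w) => [|n]; first by rewrite !big_ord0.
(* The last position starts no adjacent pair; once its zero terms are removed, the pair at [a]
   corresponds to the one at [n - a.+1]. *)
rewrite big_ord_recr [RHS]big_ord_recr /=.
rewrite [X in _ + X]big1 ?addn0; last by move=> b _; rewrite ltnn andbF.
rewrite [X in _ = _ + X]big1 ?addn0; last by move=> b _; have := ltn_ord b; lia.
rewrite (reindex_inj rev_ord_inj); apply: eq_bigr => a _.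
rewrite (reindex_inj rev_ord_inj); apply: eq_bigr => b _ /=.
have := ltn_ord a; have := ltn_ord b => lt_b lt_a.
rewrite !nth_rev ?def_n ?subSS //; last by lia.
rewrite (_ : (n - a.+1).+1 = n - a); last by lia.
by rewrite (_ : n - a < n.+1) ?andTb; [congr (nat_of_bool (_ && _)); lia | lia].
Qed.

(** * Generating functions over 231-avoiding words *)

Definition P13 x y z := (x < z) && (z < y).
Definition P31 x y z := (y < z) && (z < x).

Lemma adj_shift (r : rel nat) k s : (forall x y, r (k + x) (k + y) = r x y) ->
  adj r (map (addn k) s) = adj r s.
Proof. by move=> rk; rewrite adj_map; apply: eq_in_adj => x y _ _; apply: rk. Qed.

Lemma fstat_shift P k s : (forall x y z, P (k + x) (k + y) (k + z) = P x y z) ->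
  fstat P (map (addn k) s) = fstat P s.
Proof. by move=> Pk; rewrite fstat_map; apply: eq_in_fstat => x y z _ _ _; apply: Pk. Qed.

Lemma count_in0 (p : pred nat) s : {in s, forall x, ~~ p x} -> count p s = 0.
Proof. by move=> p0; apply/eqP; rewrite -leqn0 leqNgt -has_count; apply/hasPn. Qed.

Lemma adj_cat_const (r : rel nat) (b : bool) L R :
  {in L & R, forall x y, r x y = b} ->
  adj r (L ++ R) = adj r L + adj r R + [&& b, 0 < size L & 0 < size R].
Proof.
case: L R => [|x L] [|y R] rb; rewrite ?cats0 ?andbF ?addn0 //.
by rewrite cat_cons adj_cat rb ?mem_last ?mem_head // !andbT addnAC.
Qed.

Lemma count_gt_iota x k : count (ltn x) (iota 1 k) = k - x.
Proof.
by elim: k => // n IH; rewrite -[n.+1]addn1 iotaD count_cat IH /=; lia.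
Qed.

Section GlueStat.
Variables (X Y : seq nat) (k l : nat).
Hypotheses (Xk : X \in words k) (Yl : Y \in words l).

(** The step into the maximum is an ascent, the step out of it a descent, and each exists only if
    the block on that side is nonempty. *)
Lemma desc_glue_max : adj gtn (glue_max X Y) = adj gtn X + adj gtn Y + (0 < l).
Proof.
rewrite /glue_max (@adj_cat_const _ false); last first.
  by move=> x y xX /(glue_max_ltl Xk Yl xX) xy; rewrite /= ltnNge ltnW.
rewrite -cat1s (@adj_cat_const _ true); last first.
  by move=> x y; rewrite inE => /eqP -> /(glue_max_ltr Yl).
rewrite adj_shift => [|x y]; last by rewrite /= ltn_add2l.
by rewrite size_map (words_size Yl) /= addn0 addnA.
Qed.

Lemma asc_glue_max : adj ltn (glue_max X Y) = adj ltn X + adj ltn Y + (0 < k).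
Proof.
rewrite /glue_max (@adj_cat_const _ true); last first.
  by move=> x y xX /(glue_max_ltl Xk Yl xX).
rewrite -cat1s (@adj_cat_const _ false); last first.
  by move=> x y; rewrite inE => /eqP -> /(glue_max_ltr Yl) ? /=; rewrite ltnNge ltnW.
rewrite adj_shift => [|x y]; last by rewrite /= ltn_add2l.
by rewrite (words_size Xk) /= addn0 andbT.
Qed.

(** The first letter descends into a nonempty [X], while the step into the raised [Y] is always an
    ascent. *)
Lemma desc_glue_head : adj gtn (glue_head X Y) = adj gtn X + adj gtn Y + (0 < k).
Proof.
have XY : {in X & map (addn (size X).+1) Y, forall x y, x < y}.
  by move=> x y /(glue_head_ltl Xk) ? /(glue_head_ltr Yl); apply: ltn_trans.
rewrite /glue_head -cat_cons (@adj_cat_const _ false); last first.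
  move=> x y; rewrite inE => /predU1P[->|xX] yY; rewrite /= ltnNge ltnW //.
    exact: (glue_head_ltr Yl).
  exact: XY.
rewrite -cat1s (@adj_cat_const _ true); last first.
  by move=> x y; rewrite inE => /eqP -> /(glue_head_ltl Xk).
rewrite adj_shift => [|x y]; last by rewrite /= ltn_add2l.
by rewrite (words_size Xk) /= addn0 add0n addnAC.
Qed.

Lemma asc_glue_head : adj ltn (glue_head X Y) = adj ltn X + adj ltn Y + (0 < l).
Proof.
have XY : {in X & map (addn (size X).+1) Y, forall x y, x < y}.
  by move=> x y /(glue_head_ltl Xk) ? /(glue_head_ltr Yl); apply: ltn_trans.
rewrite /glue_head -cat_cons (@adj_cat_const _ true); last first.
  move=> x y; rewrite inE => /predU1P[->|xX] yY; last exact: XY.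
  exact: (glue_head_ltr Yl).
rewrite -cat1s (@adj_cat_const _ false); last first.
  by move=> x y; rewrite inE => /eqP -> /(glue_head_ltl Xk) ? /=; rewrite ltnNge ltnW.
rewrite adj_shift => [|x y]; last by rewrite /= ltn_add2l.
by rewrite size_map (words_size Yl) /= addn0 add0n.
Qed.

(** If [X] is nonempty, its last letter and the maximum enclose all [l] letters of the right block.
    Pairs inside [X] lie below that block, and the pair starting at the maximum is a descent. *)
Lemma fstat13_glue_max :
  fstat P13 (glue_max X Y) = fstat P13 X + fstat P13 Y + (0 < k) * l.
Proof.
have ltXY := glue_max_ltl Xk Yl; have ltY := glue_max_ltr (X := X) Yl.
rewrite /glue_max; set Y' := map _ Y in ltXY ltY *; set m := _.+1 in ltXY ltY *.
have fY : fstat P13 (m :: Y') = fstat P13 Y.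
  have fY' : fstat P13 Y' = fstat P13 Y.
    by apply: fstat_shift => x y z; rewrite /P13 !ltn_add2l.
  rewrite -fY'; case: (Y') ltY => // y s ltY; rewrite fstat_cons2 count_in0 // => z zs.
  by have := ltY z; rewrite inE zs orbT /P13 => /(_ isT); lia.
have szY : size Y' = l by rewrite size_map (words_size Yl).
rewrite -(words_size Xk) -szY; clearbody m Y'.
case: X ltXY => [|x L] ltXY; first by rewrite cat0s fY addn0.
rewrite cat_cons fstat_cat => [|y z yL zL]; last first.
  by apply/allP => u /(ltXY z); rewrite /P13 => /(_ zL); lia.
rewrite fY mul1n addnAC; congr (_ + _); apply/eqP.
rewrite -all_count; apply/allP => y yY; rewrite /P13 ltY // andbT.
by apply: ltXY; rewrite ?mem_last // inE yY orbT.
Qed.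

(** The first letter and the head of [X] enclose exactly the letters of [X] above its head; for
    empty [X] the correction is [0 - 0]. The step into the raised [Y] is an ascent and starts no
    31-2. *)
Lemma fstat31_glue_head :
  fstat P31 (glue_head X Y) = fstat P31 X + fstat P31 Y + (size X - head 0 X).
Proof.
have ltX := glue_head_ltl Xk; have ltY := glue_head_ltr (X := X) Yl.
rewrite /glue_head; set Y' := map _ Y in ltY *; set a := _.+1 in ltX ltY *.
have -> : fstat P31 Y = fstat P31 Y'.
  by apply/esym/fstat_shift => x y z; rewrite /P31 !ltn_add2l.
clearbody a Y'.
have XY : fstat P31 (X ++ Y') = fstat P31 X + fstat P31 Y'.
  case: X (Y') ltX ltY => [|x L] [|y R] ltX ltY; rewrite ?cats0 ?addn0 //.
  rewrite cat_cons fstat_cat => [|u v uL vL]; last first.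
    apply/allP => z /ltY; have := ltX _ uL; rewrite /P31; lia.
  rewrite count_in0 ?addn0 // => z zR; have := ltX _ (mem_last x L).
  by have := ltY y (mem_head _ _); rewrite /P31; lia.
(* As [X] is a permutation of [iota 1 k], exactly [k - x] of its letters exceed [x]. *)
have cX x : x = head 0 X -> count (ltn x) X = size X - head 0 X.
  have := Xk; rewrite mem_words => /andP[_ XP] ->.
  by rewrite (seq.permP XP) count_gt_iota (words_size Xk).
rewrite -XY addnC; case: X ltX ltY cX {XY} => [|x L] ltX ltY cX.
  rewrite cat0s [size _]/= sub0n add0n; case: (Y') ltY => // y s ltY.
  rewrite fstat_cons2 count_in0 // => z zs.
  by have := ltY y (mem_head _ _); rewrite /P31; lia.
rewrite -(cX x) // cat_cons fstat_cons2; congr (_ + _).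
rewrite count_cat [RHS]/= ltnn add0n [X in _ + X]count_in0 ?addn0 => [|z /ltY]; last first.
  by rewrite /P31; lia.
by apply: eq_in_count => z zL; rewrite /P31 ltX ?andbT // inE zL orbT.
Qed.

End GlueStat.

Local Open Scope ring_scope.

Section GeneratingFunctions.
Variables (R : comNzRingType) (t s q : R).

(** Descents and ascents get separate variables, so that each recurrence is proved once and then
    specialised at [s = 1] or [t = 1]. *)
Definition weight P (w : seq nat) : R :=
  t ^+ adj gtn w * s ^+ adj ltn w * q ^+ fstat P w.

Definition gf P n := \sum_(w <- words n) weight P w.

(** The additional power of [q] is what [w] contributes as left block in [fstat31_glue_head]. *)
Definition gf_head n := \sum_(w <- words n) weight P31 w * q ^+ (size w - head 0%N w).

Lemma words0 : words 0 = [:: [::]].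
Proof. by []. Qed.

Lemma gf0 P : gf P 0 = 1.
Proof. by rewrite /gf words0 big_seq1 /weight /= !mulr1. Qed.

Lemma gf_head0 : gf_head 0 = 1.
Proof. by rewrite /gf_head words0 big_seq1 /weight /= !mulr1. Qed.

Lemma gf13S n : gf P13 n.+1 = \sum_(k < n.+1) t ^+ (0 < n - k)%N * s ^+ (0 < k)%N *
  q ^+ ((0 < k) * (n - k))%N * gf P13 k * gf P13 (n - k).
Proof.
rewrite /gf (sum_words_glue glue_max_words glue_max_surj glue_max_inj).
apply: eq_bigr => k _; rewrite -mulrA big_distrlr mulr_sumr /=.
apply: eq_big_seq => X Xk; rewrite mulr_sumr; apply: eq_big_seq => Y Yk.
rewrite /weight (desc_glue_max Xk Yk) (asc_glue_max Xk Yk) (fstat13_glue_max Xk Yk).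
by rewrite !exprD; ring.
Qed.

Lemma gf31S n : gf P31 n.+1 = \sum_(k < n.+1) t ^+ (0 < k)%N * s ^+ (0 < n - k)%N *
  gf_head k * gf P31 (n - k).
Proof.
rewrite /gf (sum_words_glue glue_head_words glue_head_surj); last first.
  by move=> *; apply: glue_head_inj.
apply: eq_bigr => k _; rewrite -mulrA big_distrlr mulr_sumr /=.
apply: eq_big_seq => X Xk; rewrite mulr_sumr; apply: eq_big_seq => Y Yk.
rewrite /weight (desc_glue_head Xk Yk) (asc_glue_head Xk Yk) (fstat31_glue_head Xk Yk).
by rewrite !exprD; ring.
Qed.

(** The glued word starts with [k.+1], so its own extra exponent is [n - k]; the factor [gf_head k]
    again comes from the pair at the first letter. *)
Lemma gf_headS n : gf_head n.+1 = \sum_(k < n.+1) t ^+ (0 < k)%N *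
  s ^+ (0 < n - k)%N * q ^+ (n - k) * gf_head k * gf P31 (n - k).
Proof.
rewrite {1}/gf_head (sum_words_glue glue_head_words glue_head_surj); last first.
  by move=> *; apply: glue_head_inj.
apply: eq_bigr => k _; rewrite -mulrA big_distrlr mulr_sumr /=.
apply: eq_big_seq => X Xk; rewrite mulr_sumr; apply: eq_big_seq => Y Yk.
rewrite /weight (desc_glue_head Xk Yk) (asc_glue_head Xk Yk) (fstat31_glue_head Xk Yk).
rewrite [size _]/= size_cat size_map subSS addKn (words_size Yk).
by rewrite !exprD; ring.
Qed.

End GeneratingFunctions.

Section FourSums.
Variables (R : comNzRingType) (t q : R) (n : nat).

Lemma gf13_des : gf t 1 q P13 n = qtCatalan t q n.
Proof.
apply: catalan_rec_uniq (qtCatalan_rec t q) n; apply: catalan_rec_max_des; first exact: gf0.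
by move=> m; rewrite gf13S; apply: eq_bigr => k _; rewrite expr1n mulr1.
Qed.

Lemma gf13_asc : gf 1 t q P13 n = qtCatalan t q n.
Proof.
apply: catalan_rec_uniq (qtCatalan_rec t q) n; apply: catalan_rec_max_asc; first exact: gf0.
by move=> m; rewrite gf13S; apply: eq_bigr => k _; rewrite expr1n mul1r.
Qed.

Lemma gf31_des : gf t 1 q P31 n = qtCatalan t q n.
Proof.
apply: catalan_rec_uniq (qtCatalan_rec t q) n.
apply: (@catalan_rec_head_des _ _ _ _ (gf_head t 1 q)) => [||m|m].
- exact: gf0.
- exact: gf_head0.
- by rewrite gf31S; apply: eq_bigr => k _; rewrite expr1n mulr1.
by rewrite gf_headS; apply: eq_bigr => k _; rewrite expr1n mulr1.
Qed.

Lemma gf31_asc : gf 1 t q P31 n = qtCatalan t q n.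
Proof.
apply: catalan_rec_uniq (qtCatalan_rec t q) n.
apply: (@catalan_rec_head_asc _ _ _ _ (gf_head 1 t q)) => [||m|m].
- exact: gf0.
- exact: gf_head0.
- by rewrite gf31S; apply: eq_bigr => k _; rewrite expr1n mul1r.
by rewrite gf_headS; apply: eq_bigr => k _; rewrite expr1n mul1r.
Qed.

End FourSums.

(** * Reduction of the ten sums by symmetry *)

Lemma perm_word_iota n (p : 'S_n) : perm_eq (perm_word p) (iota 1 n).
Proof.
rewrite (iotaDl 1 0) -val_enum_ord -map_comp /perm_word.
rewrite (map_comp (fun i : 'I_n => i.+1) p); apply: perm_map.
apply: uniq_perm; rewrite ?(map_inj_uniq perm_inj) ?enum_uniq // => i.
rewrite mem_enum; apply/mapP; exists (p^-1%g i); rewrite ?mem_enum //.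
by rewrite permKV.
Qed.

Lemma perm_word_inj n : injective (@perm_word n).
Proof.
move=> p p' /eq_in_map pp'; apply/permP => i; apply: val_inj.
by have [] := pp' i (mem_enum _ _).
Qed.

Lemma sum_perm_words (V : nmodType) n (P : pred (seq nat)) (F : seq nat -> V) :
  \sum_(p : 'S_n | P (perm_word p)) F (perm_word p) =
  \sum_(w <- permutations (iota 1 n) | P w) F w.
Proof.
rewrite -(big_map (@perm_word n) P F); apply: perm_big.
have uniq_w : uniq [seq perm_word p | p <- index_enum {perm 'I_n}].
  by rewrite (map_inj_uniq (@perm_word_inj n)) index_enum_uniq.
apply: uniq_perm (permutations_uniq _) _ => //.
(* Surjectivity by counting: the words of permutations are distinct, and there are [n!] of them on
   either side. *)
refine (uniq_min_size uniq_w _ _).2 => [_ /mapP[p _ ->]|].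
  by rewrite mem_permutations perm_word_iota.
rewrite size_permutations ?iota_uniq // size_iota size_map -(card_Sn n).
by rewrite cardT enumT [index_enum _]unlock.
Qed.

Definition dihedral (c r : bool) n (w : seq nat) :=
  let w' := if c then map (subn n.+1) w else w in if r then rev w' else w'.

Section Dihedral.
Variables (c r : bool) (n : nat).

Lemma dihedral_iota w : perm_eq w (iota 1 n) -> perm_eq (dihedral c r n w) (iota 1 n).
Proof.
move=> wP; rewrite /dihedral.
have cP : perm_eq (if c then map (subn n.+1) w else w) (iota 1 n).
  case: c => //; apply: perm_trans (perm_map _ wP) _; apply: uniq_perm.
  - rewrite map_inj_in_uniq ?iota_uniq // => x y; rewrite !mem_iota; lia.
  - exact: iota_uniq.
  move=> x; rewrite mem_iota; apply/mapP/idP => [[y] | xn].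
    by rewrite mem_iota; lia.
  by exists (n.+1 - x)%N; rewrite ?mem_iota; lia.
by case: r; rewrite ?perm_rev.
Qed.

(** Reversal and complement are commuting involutions; subtraction truncates, so the letters must
    not exceed [n.+1]. *)
Lemma dihedralK w : perm_eq w (iota 1 n) ->
  dihedral c r n (dihedral c r n w) = w.
Proof.
move=> wP; rewrite /dihedral.
have cK : map (subn n.+1) (map (subn n.+1) w) = w.
  rewrite -map_comp map_id_in // => x; rewrite (perm_mem wP) mem_iota /=; lia.
by case: c r => -[]; rewrite -?map_rev ?revK.
Qed.

Lemma sum_dihedral (V : nmodType) (P : pred (seq nat)) (F : seq nat -> V) :
  \sum_(w <- permutations (iota 1 n) | P w) F w =
  \sum_(w <- permutations (iota 1 n) | P (dihedral c r n w)) F (dihedral c r n w).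
Proof.
rewrite -(big_map (dihedral c r n) P F); apply: perm_big.
have dK : {in permutations (iota 1 n), cancel (dihedral c r n) (dihedral c r n)}.
  by move=> w; rewrite mem_permutations => /dihedralK.
apply: uniq_perm; rewrite ?permutations_uniq //.
  by rewrite (map_inj_in_uniq (can_in_inj dK)) permutations_uniq.
move=> w; rewrite mem_permutations; apply/idP/mapP => [wP | [v + ->]].
  by exists (dihedral c r n w); rewrite ?dihedralK // mem_permutations dihedral_iota.
by rewrite mem_permutations => /dihedral_iota.
Qed.

End Dihedral.

(** The statistic is compared on 231-avoiding words only, which admits [adi] and [adi_star]. *)
Lemma catalan_identity_dihedral (c r : bool) tau stat (d : rel nat) P :
  (forall n w, perm_eq w (iota 1 n) -> avoids tau (dihedral c r n w) = av231 w) ->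
  (forall n w, perm_eq w (iota 1 n) -> des (dihedral c r n w) = adj d w) ->
  (forall n w, w \in words n -> stat (dihedral c r n w) = fstat P w) ->
  (forall (R : comNzRingType) (t q : R) n,
     \sum_(w <- words n) t ^+ adj d w * q ^+ fstat P w = qtCatalan t q n) ->
  catalan_identity tau stat.
Proof.
move=> avE desE' statE sumE R t q n; rewrite -sumE big_filter.
rewrite (sum_perm_words n (avoids tau) (fun w => t ^+ des w * q ^+ stat w)).
rewrite (sum_dihedral c r) big_seq_cond [RHS]big_seq_cond.
apply: eq_big => w; rewrite mem_permutations.
  by case: (boolP (perm_eq _ _)) => // wP; rewrite avE.
by case/andP => wP wav; rewrite desE' // (statE n) // mem_words wav.
Qed.

(** Complement carries 231 to 213, reversal carries it to 132, and both together to 312. *)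
Lemma avoids_dihedral c r n w : perm_eq w (iota 1 n) ->
  avoids (if c then if r then [:: 3; 1; 2] else [:: 2; 1; 3]
          else if r then [:: 1; 3; 2] else [:: 2; 3; 1])%N (dihedral c r n w) =
  av231 w.
Proof.
move=> wP.
have wn x : x \in w -> (0 < x <= n)%N by rewrite (perm_mem wP) mem_iota; lia.
case: c r => -[]; rewrite avoidsE /dihedral ?avoids3_rev ?avoids3_map;
  apply: eq_in_avoids3 => x y z /wn ? /wn ? /wn ?; rewrite order_iso3 /P231 /=;
  apply/idP/idP; lia.
Qed.

(** Complement and reversal each exchange descents with ascents, hence the exclusive or. *)
Lemma des_dihedral c r n w : perm_eq w (iota 1 n) ->
  des (dihedral c r n w) = adj (if c (+) r then ltn else gtn) w.
Proof.
move=> wP.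
have wn x : x \in w -> (0 < x <= n)%N by rewrite (perm_mem wP) mem_iota; lia.
by case: c r => -[]; rewrite desE /dihedral ?adj_rev ?adj_map;
  apply: eq_in_adj => x y /wn ? /wn ? /=; lia.
Qed.

Section DihedralStat.
Variables (n : nat) (w : seq nat).
Hypothesis wn : w \in words n.

Lemma fstat_compl P Q :
  (forall x y z, (0 < x <= n)%N -> (0 < y <= n)%N -> (0 < z <= n)%N ->
    P (n.+1 - x)%N (n.+1 - y)%N (n.+1 - z)%N = Q x y z) ->
  fstat P (map (subn n.+1) w) = fstat Q w.
Proof.
move=> PQ; rewrite fstat_map.
have v := words_val wn.
by apply: eq_in_fstat => x y z /v ? /v ? /v ?; apply: PQ.
Qed.

Lemma st13_2E : st13_2 w = fstat P13 w.
Proof. exact: (fsumE P13). Qed.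

Lemma st31_2E : st31_2 w = fstat P31 w.
Proof. exact: (fsumE P31). Qed.

(** Reversal takes 13-2 to 2-31, which complement takes to 2-13. *)
Lemma st2_13_rc : st2_13 (dihedral true true n w) = fstat P13 w.
Proof.
rewrite [LHS](bsumE P13) revK; apply: fstat_compl => x y z; rewrite /P13; lia.
Qed.

Lemma st2_31_rc : st2_31 (dihedral true true n w) = fstat P31 w.
Proof.
rewrite [LHS](bsumE P31) revK; apply: fstat_compl => x y z; rewrite /P31; lia.
Qed.

Lemma st31_2_compl : st31_2 (dihedral true false n w) = fstat P13 w.
Proof. rewrite [LHS](fsumE P31); apply: fstat_compl => x y z; rewrite /P31 /P13; lia. Qed.

Lemma st13_2_compl : st13_2 (dihedral true false n w) = fstat P31 w.
Proof. rewrite [LHS](fsumE P13); apply: fstat_compl => x y z; rewrite /P31 /P13; lia. Qed.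

Lemma st2_31_rev : st2_31 (dihedral false true n w) = fstat P13 w.
Proof. by rewrite [LHS](bsumE P31) revK. Qed.

Lemma st2_13_rev : st2_13 (dihedral false true n w) = fstat P31 w.
Proof. by rewrite [LHS](bsumE P13) revK. Qed.

(* In a 231-avoiding word no [l] lies between [i] and [j] with a larger value,
   so [(i, j)] is star admissible iff [(i - 1, j)] is an occurrence of 13-2. *)
Lemma adi_star_av231 : adi_star w = st13_2 w.
Proof.
have := wn; rewrite mem_words => /andP[wav _].
have av i j k := @avoids3_nth P231 w i j k wav.
have wle i : (nth 0 w i <= size w)%N.
  case: (ltnP i (size w)) => [iw|iw]; last by rewrite nth_default.
  by rewrite (words_size wn); case/andP: (words_val wn (mem_nth 0%N iw)).
rewrite /adi_star /st13_2; case sz_w: (size w) => [|m]; first by rewrite !big_ord0.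
rewrite sz_w in wle av.
(* Position 0 starts no star admissible inversion, since the value placed before it exceeds all
   letters. Dropping it aligns position [a.+1] of [adi_star] with the pair at [a] of [st13_2]. *)
rewrite big_ord_recl [RHS]big_ord_recr /= big1 ?add0n => [|b _]; last first.
  case: existsP => [[l /andP[/andP[l0 lb] xl]]|_]; last first.
    by rewrite orbF; have := wle 0%N; lia.
  case: (ltnP (nth 0%N w b) (nth 0%N w 0)) => [xb|]; last by lia.
  by have := av 0%N l b; rewrite /P231 l0 lb ltn_ord xl xb => /(_ isT isT).
rewrite [X in (_ + X)%N]big1 ?addn0 => [|b _]; last by have := ltn_ord b; lia.
apply: eq_bigr => a _; apply: eq_bigr => b _; rewrite /bump /= add1n.
have [ab|//] := ltnP a.+1 b; congr nat_of_bool; rewrite /=.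
have := av a a.+1 b; rewrite ltnSn ab ltn_ord /P231 => /(_ isT isT) av_ab.
have xab : nth 0%N w a != nth 0%N w b.
  by rewrite nth_uniq ?(words_uniq wn) ?sz_w //; have := ltn_ord a; lia.
rewrite add0n.
case: existsP => [[l /andP[/andP[al lb] xl]]|_]; last by rewrite orbF; lia.
have := av a.+1 l b; rewrite /P231 al lb ltn_ord xl => /(_ isT isT).
rewrite andbT => /negbTE xb.
by rewrite xb /=; lia.
Qed.

(** In the 312-avoiding word [v], a smaller letter between the two of an inversion would give a 312.
    So admissibility of [(a, b)] means an ascent at [b], whose top must exceed the letter at [a]:
    this is a 2-13. *)
Lemma adi_rc : adi (dihedral true true n w) = fstat P13 w.
Proof.
rewrite -st2_13_rc; set v := dihedral _ _ _ _.
have := wn; rewrite mem_words => /andP[wav wP].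
have vav : avoids [:: 3; 1; 2]%N v by rewrite (avoids_dihedral true true wP).
have v_uniq : uniq v by rewrite (perm_uniq (dihedral_iota true true wP)) iota_uniq.
have av i j k : (i < j < k)%N -> (k < size v)%N ->
    ~~ ((nth 0 v j < nth 0 v k) && (nth 0 v k < nth 0 v i))%N.
  move=> ijk kv; have := vav; rewrite avoidsE => /avoids3_nth/(_ ijk kv).
  by rewrite order_iso3 /=; lia.
rewrite /adi /st2_13 exchange_big; apply: eq_bigr => b _; apply: eq_bigr => a _ /=.
rewrite !ltn_ord; have [ab|//] := ltnP a b; congr nat_of_bool; rewrite /=.
case: existsP => [[l /andP[/andP[al lb]]]|_].
  rewrite ltn_ord => xl; have := av a l b; rewrite al lb ltn_ord xl => /(_ isT isT)/=.
  by move=> /negbTE ->; rewrite andbF.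
(* At the last position the convention [pi(n+1) = 0] excludes an ascent. *)
rewrite orbF; case: ifP => bv; last by rewrite ltn0 andbF.
have := av a b b.+1; rewrite ab ltnSn bv => /(_ isT isT).
have xab : nth 0%N v a != nth 0%N v b.+1.
  by rewrite nth_uniq //; lia.
by lia.
Qed.

End DihedralStat.

Section WordSums.
Variables (R : comNzRingType) (t q : R) (n : nat).

Lemma sum_words_des P :
  \sum_(w <- words n) t ^+ adj gtn w * q ^+ fstat P w = gf t 1 q P n.
Proof. by apply: eq_bigr => w _; rewrite /weight expr1n mulr1. Qed.

Lemma sum_words_asc P :
  \sum_(w <- words n) t ^+ adj ltn w * q ^+ fstat P w = gf 1 t q P n.
Proof. by apply: eq_bigr => w _; rewrite /weight expr1n mul1r. Qed.

End WordSums.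

Local Open Scope nat_scope.

Theorem theorem1p1 :
  catalan_identity [:: 2; 3; 1] st13_2 /\
      catalan_identity [:: 2; 3; 1] adi_star /\
      catalan_identity [:: 3; 1; 2] st2_13 /\
      catalan_identity [:: 3; 1; 2] adi /\
      catalan_identity [:: 2; 1; 3] st31_2 /\
      catalan_identity [:: 1; 3; 2] st2_31 /\
      catalan_identity [:: 2; 3; 1] st31_2 /\
      catalan_identity [:: 3; 1; 2] st2_31 /\
      catalan_identity [:: 2; 1; 3] st13_2  /\
      catalan_identity [:: 1; 3; 2] st2_13.
Proof.
(* The flags [c] and [r] fix the pattern and whether [t] marks descents or ascents. The eight
   choices of [c], [r], [P] give the eight vincular pairs, and [adi_star] and [adi] reuse two of
   them. *)
have reduce c r P stat :
    (forall n w, w \in words n -> stat (dihedral c r n w) = fstat P w) ->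
    P = P13 \/ P = P31 ->
    catalan_identity (if c then if r then [:: 3; 1; 2] else [:: 2; 1; 3]
                      else if r then [:: 1; 3; 2] else [:: 2; 3; 1])%N stat.
  move=> statE PE; apply: (catalan_identity_dihedral _ _ statE).
  - by move=> n w; apply: avoids_dihedral.
  - by move=> n w; apply: des_dihedral.
  move=> R t q n; case: (c (+) r); rewrite ?sum_words_asc ?sum_words_des.
    by case: PE => ->; rewrite ?gf13_asc ?gf31_asc.
  by case: PE => ->; rewrite ?gf13_des ?gf31_des.
have [l13 l31] : (P13 = P13 \/ P13 = P31) /\ (P31 = P13 \/ P31 = P31).
  by split; [left | right].
do 9?split.
- by apply: (reduce false false P13) => // n w _; apply: st13_2E.
- apply: (reduce false false P13) => // n w wn.
  by rewrite -st13_2E; apply: adi_star_av231 wn.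
- by apply: (reduce true true P13) => // n w; apply: st2_13_rc.
- by apply: (reduce true true P13) => // n w; apply: adi_rc.
- by apply: (reduce true false P13) => // n w; apply: st31_2_compl.
- by apply: (reduce false true P13) => // n w _; apply: st2_31_rev.
- by apply: (reduce false false P31) => // n w _; apply: st31_2E.
- by apply: (reduce true true P31) => // n w; apply: st2_31_rc.
- by apply: (reduce true false P31) => // n w; apply: st13_2_compl.
by apply: (reduce false true P31) => // n w _; apply: st2_13_rev.
Qed.
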